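(* Let $f:(0,\infty)^2\to(0,\infty)$ be a symmetric real function that is increasing in the variable $x$. Let $G$ be a connected graph and let $v_1$ be a vertex of $G$ of degree $2$ with neighbors $v_2$ and $v_3$. If $v_2v_3\in E(G)$, then $\rho_f(G_{v_1v_2})\leq\rho_f(G)$.
   Context: All graphs are finite, simple and undirected. For a connected graph $G$ with vertices $v_1,\dots,v_n$ of degrees $d_1,\dots,d_n$, the $f$-adjacency matrix $A_f(G)$ has $(i,j)$-entry $f(d_i,d_j)$ if $v_iv_j\in E(G)$ and $0$ otherwise; $\rho_f(G)$ is the spectral radius of $A_f(G)$. For an edge $e=uv$ of $G$, $G_e$ (also written $G_{uv}$) is the graph obtained by subdividing $e$, i.e. deleting $e$ and adding a new vertex $w$ with edges $uw$ and $wv$. ''Increasing in the variable $x$'' means non-decreasing in $x$ for each fixed $y$. *)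

(* Defs.v *)
From HB Require Import structures.
From mathcomp Require Import all_boot all_order all_algebra.
From mathcomp Require Import boolp classical_sets reals.
From mathcomp Require Import complex.

Set Implicit Arguments.
Unset Strict Implicit.
Unset Printing Implicit Defensive.

Import Order.TTheory GRing.Theory Num.Theory.

Local Open Scope ring_scope.

Record sgraph := SGraph {
  svertex :> finType;
  sedge : rel svertex;
  sedge_sym : symmetric sedge;
  sedge_irr : irreflexive sedge
}.

Definition neighbors (G : sgraph) (x : G) : {set G} := [set y | sedge x y].

Definition degree (G : sgraph) (x : G) : nat := #|neighbors x|.

Definition connected_graph (G : sgraph) : Prop :=
  (0 < #|G|)%N /\ forall x y : G, connect (@sedge G) x y.

(* The new vertex is [None].  This is the subdivision of the edge [uv] only
   when [sedge u v] and should only be used then. *)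
Definition subdiv_rel (G : sgraph) (u v : G) : rel (option G) := fun a b =>
  match a, b with
  | Some x, Some y => sedge x y && ([set x; y] != [set u; v])
  | Some x, None | None, Some x => x \in [set u; v]
  | None, None => false
  end.

Lemma subdiv_sym (G : sgraph) (u v : G) : symmetric (subdiv_rel u v).
Proof. by case=> [x|] [y|] //=; rewrite (@sedge_sym G) finset.setUC. Qed.

Lemma subdiv_irr (G : sgraph) (u v : G) : irreflexive (subdiv_rel u v).
Proof. by case=> [x|] //=; rewrite (@sedge_irr G). Qed.

Definition subdivide (G : sgraph) (u v : G) : sgraph :=
  SGraph (subdiv_sym u v) (subdiv_irr u v).

Definition f_adjacency (R : realType) (f : R -> R -> R) (G : sgraph) :
    'M[R]_#|G| :=
  \matrix_(i, j)
    let x : G := enum_val i in let y : G := enum_val j in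
    if sedge x y then f (degree x)%:R (degree y)%:R else 0.

(* [Normc.normc z] is the modulus of [z : R[i]], as an element of [R]. *)
Definition spectral_radius (R : realType) (n : nat) (A : 'M[R]_n) : R :=
  sup [set Normc.normc z | z in
        [set z : R[i] | eigenvalue (map_mx (real_complex R) A) z]]%classic.

Definition f_spectral_radius (R : realType) (f : R -> R -> R) (G : sgraph) : R :=
  spectral_radius (f_adjacency f G).

(* Main.v *)
(** Let [r] be the spectral radius of the subdivided graph, [x >= 0] an
    eigenvector for it, and [a], [b] its values at the subdividing vertex and
    at [v1].  The eigenvalue equations at these two vertices and at [v2], [v3]
    force [a <= x v2] and [b <= x v3].  Collapsing the edge between the new
    vertex and [v1] and giving the merged vertex the value [max a b] therefore
    yields a nonnegative [y] on [G] with [r y <= A y] entrywise, so [r] is at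
    most the Rayleigh quotient of [y], hence at most the spectral radius of
    [G]. *)
Require Import Defs.
From HB Require Import structures.
From mathcomp Require Import all_boot all_order all_algebra.
From mathcomp Require Import boolp classical_sets reals.
From mathcomp Require Import complex lra.

Set Implicit Arguments.
Unset Strict Implicit.
Unset Printing Implicit Defensive.

Import Order.TTheory GRing.Theory Num.Theory.

Local Open Scope ring_scope.

Section SymmetricMatrix.
Local Open Scope sesquilinear_scope.
Variables (R : realType) (n : nat) (A : 'M[R]_n).
Hypothesis A_sym : A^T = A.

Local Notation toC := (real_complex R).
Local Notation AC := (map_mx toC A).
Local Notation rho := (spectral_radius A).

Lemma conjC_real_complex (x : R) : Num.conj (toC x) = toC x.
Proof. by apply/CrealP/complex_realP; exists x. Qed.

Lemma normc_real_complex (x : R) : Normc.normc (toC x) = `|x|.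
Proof. by rewrite /= expr0n /= addr0 sqrtr_sqr. Qed.

Lemma symmetric_spectral : exists (P : 'M[R[i]]_n) (d : 'rV[R]_n),
  P \is unitarymx /\ AC = P^t* *m diag_mx (map_mx toC d) *m P.
Proof.
have AC_herm : AC \is hermsymmx.
  apply: realsym_hermsym.
    apply/is_hermitianmxP.
    by rewrite /= expr0 scale1r map_mx_id // map_trmx A_sym.
  by apply/mxOverP => i j; rewrite mxE; apply/complex_realP; eexists.
have U := spectral_unitarymx AC.
exists (spectralmx AC), (map_mx (@complex.Re R) (spectral_diag AC)).
split=> //; have /hermitian_normalmx/orthomx_spectralP := AC_herm.
rewrite invmx_unitary // => {1}->; congr (_ *m diag_mx _ *m _).
apply/matrixP => i j; rewrite !mxE RRe_real //.
exact: (mxOverP (hermitian_spectral_diag_real AC_herm)).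
Qed.

Lemma eigenvalue_spectral (P : 'M[R[i]]_n) (d : 'rV[R]_n) (z : R[i]) :
  P \is unitarymx -> AC = P^t* *m diag_mx (map_mx toC d) *m P ->
  reflect (exists i, z = toC (d 0 i)) (eigenvalue AC z).
Proof.
move=> U AE; have PP : P *m P^t* = 1%:M by apply/unitarymxP.
apply: (iffP eigenvalueP) => [[v vA v0]|[i ->]].
  have : v *m P^t* != 0.
    by apply: contraNneq v0 => /(congr1 (mulmx^~ P)); rewrite mulmxKtV // mul0mx => ->.
  move=> /rV0Pn [i ui]; exists i.
  have /(congr1 (mulmx^~ (P^t*))) := vA.
  rewrite AE !mulmxA mulmxtVK // -scalemxAl mul_mx_diag => /matrixP/(_ 0 i).
  set u := v *m _ in ui *; rewrite mxE [map_mx _ d _ _]mxE [RHS]mxE mulrC.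
  by move/(mulIf ui).
exists (row i P).
  rewrite AE rowE !mulmxA -(mulmxA _ P) PP mulmx1.
  rewrite mul_mx_diag scalemxAl; congr (_ *m _); apply/matrixP => k j.
  by rewrite !mxE; have [->|_] := eqVneq j i; rewrite ?andbF ?mulr0 ?mul0r // mulrC.
apply/eqP => /(congr1 (mulmx^~ (P^t*))); rewrite rowE -mulmxA PP mulmx1 mul0mx.
by move=> /matrixP/(_ 0 i); rewrite !mxE !eqxx => /eqP; rewrite oner_eq0.
Qed.

Lemma spectral_radius_diag (P : 'M[R[i]]_n) (d : 'rV[R]_n) :
  (0 < n)%N ->
  P \is unitarymx -> AC = P^t* *m diag_mx (map_mx toC d) *m P ->
  (forall i, `|d 0 i| <= rho) /\ exists i, `|d 0 i| = rho.
Proof.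
move=> n_gt0 U AE; pose i0 := Ordinal n_gt0.
have [k _ kmax] := Order.TotalTheory.arg_maxP (fun i => `|d 0 i|) (erefl : predT i0).
suff -> : rho = `|d 0 k| by split=> [i|]; [exact: kmax | exists k].
rewrite /spectral_radius; set S := (X in sup X).
have Sk : S `|d 0 k|.
  exists (toC (d 0 k)); last exact: normc_real_complex.
  by apply/(eigenvalue_spectral _ U AE); exists k.
have Sub : ubound S `|d 0 k|.
  move=> _ [_ /(eigenvalue_spectral _ U AE)[i ->] <-].
  by rewrite normc_real_complex; exact: kmax.
apply/eqP; rewrite eq_le ge_sup //; last by exists `|d 0 k|.
by rewrite ub_le_sup //; exists `|d 0 k|.
Qed.

Lemma spectral_radius_ge0 : (0 < n)%N -> 0 <= rho.
Proof.
move=> n0; have [P [d [U AE]]] := symmetric_spectral.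
by have [_ [i <-]] := spectral_radius_diag n0 U AE.
Qed.

Lemma spectral_radius_eigen : (0 < n)%N ->
  exists2 z : R[i], eigenvalue AC z & Normc.normc z = rho.
Proof.
move=> n0; have [P [d [U AE]]] := symmetric_spectral.
have [_ [i di]] := spectral_radius_diag n0 U AE.
exists (toC (d 0 i)); last by rewrite normc_real_complex.
by apply/(eigenvalue_spectral _ U AE); exists i.
Qed.

Lemma rayleigh_gap (x : 'rV[R]_n) (P : 'M[R[i]]_n) (d : 'rV[R]_n) 
    (y := map_mx toC x *m P^t*) :
  P \is unitarymx -> AC = P^t* *m diag_mx (map_mx toC d) *m P ->
  toC (rho * (x *m x^T) 0 0 - (x *m A *m x^T) 0 0) =
  \sum_i toC (rho - d 0 i) * `|y 0 i| ^+ 2.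
Proof.
move=> U AE.
have yt : y^t* = P *m map_mx toC x^T.
  rewrite /y trmx_mul map_mxM trmxCK; congr (_ *m _).
  by apply/matrixP => i j; rewrite !mxE; exact: conjC_real_complex.
have yy : y *m y^t* = map_mx toC (x *m x^T).
  by rewrite yt /y mulmxA mulmxKtV // map_mxM.
have yDy : y *m diag_mx (map_mx toC d) *m y^t* = map_mx toC (x *m A *m x^T).
  by rewrite yt /y 2!map_mxM AE !mulmxA.
rewrite rmorphB rmorphM /=.
move/matrixP/(_ 0 0): yy; rewrite mxE [RHS]mxE => <-.
move/matrixP/(_ 0 0): yDy; rewrite mul_mx_diag mxE [RHS]mxE => <-.
clearbody y; rewrite mulr_sumr -sumrB; apply: eq_bigr => i _.
rewrite [y^t* _ _]mxE [_^T _ _]mxE mxE [map_mx _ d _ _]mxE normCK rmorphB mulrBl.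
by congr (_ - _); rewrite mulrA; congr (_ * _); rewrite mulrC.
Qed.

Lemma rayleigh_le (x : 'rV[R]_n) : (0 < n)%N ->
  (x *m A *m x^T) 0 0 <= rho * (x *m x^T) 0 0.
Proof.
move=> n0; have [P [d [U AE]]] := symmetric_spectral.
have [dle _] := spectral_radius_diag n0 U AE.
rewrite -subr_ge0 -lecR (rayleigh_gap x U AE) sumr_ge0 // => i _.
by rewrite mulr_ge0 ?exprn_ge0 // lecR subr_ge0 (le_trans (ler_norm _)).
Qed.

Lemma rayleigh_eq (x : 'rV[R]_n) : (0 < n)%N ->
  (x *m A *m x^T) 0 0 = rho * (x *m x^T) 0 0 -> x *m A = rho *: x.
Proof.
move=> n0 xAx; have [P [d [U AE]]] := symmetric_spectral.
have [dle _] := spectral_radius_diag n0 U AE.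
have := rayleigh_gap x U AE; rewrite xAx subrr; set y := _ *m P^t*.
have ge0 i : predT i -> 0 <= toC (rho - d 0 i) * `|y 0 i| ^+ 2.
  by move=> _; rewrite mulr_ge0 ?exprn_ge0 // lecR subr_ge0 (le_trans (ler_norm _)).
move=> /esym/(psumr_eq0P ge0) sum0.
have yD : y *m diag_mx (map_mx toC d) = toC rho *: y.
  apply/matrixP => k i; rewrite ord1 mul_mx_diag mxE [map_mx _ d _ _]mxE [RHS]mxE mulrC.
  move/eqP: (sum0 i isT); rewrite mulf_eq0 expf_eq0 /= normr_eq0 rmorphB /= subr_eq0.
  by case/orP => /eqP->; rewrite ?mulr0.
have eqC : map_mx toC (x *m A) = map_mx toC (rho *: x).
  by rewrite map_mxZ map_mxM AE !mulmxA -/y yD -scalemxAl mulmxKtV.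
apply/matrixP => i j; apply: (@complexI R).
by move/matrixP/(_ i j): eqC; rewrite mxE [RHS]mxE.
Qed.

Lemma row_dotE (u v : 'rV[R]_n) : (u *m v^T) 0 0 = \sum_i u 0 i * v 0 i.
Proof. by rewrite mxE; apply: eq_bigr => i _; rewrite mxE. Qed.

Lemma row_dot_gt0 (u : 'rV[R]_n) : u != 0 -> 0 < (u *m u^T) 0 0.
Proof.
move=> /rV0Pn[i ui]; rewrite row_dotE (bigD1 i) //= ltr_wpDr //.
  by apply: sumr_ge0 => j _; rewrite -expr2 sqr_ge0.
by rewrite -expr2 lt0r sqrf_eq0 ui sqr_ge0.
Qed.

Lemma rayleigh_subeigen (c : R) (y : 'rV[R]_n) :
  (forall i, 0 <= y 0 i) -> (forall i, c * y 0 i <= (y *m A) 0 i) ->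
  c * (y *m y^T) 0 0 <= (y *m A *m y^T) 0 0.
Proof.
move=> y_ge0 cy; rewrite !row_dotE mulr_sumr ler_sum // => i _.
by rewrite mulrA ler_wpM2r.
Qed.

Lemma subeigen_le_spectral_radius (c : R) (y : 'rV[R]_n) :
  y != 0 -> (forall i, 0 <= y 0 i) -> (forall i, c * y 0 i <= (y *m A) 0 i) ->
  c <= rho.
Proof.
move=> y0 y_ge0 cy; have n0 : (0 < n)%N.
  by case/rV0Pn: y0 => i _; apply: leq_ltn_trans (ltn_ord i).
rewrite -(ler_pM2r (row_dot_gt0 y0)).
exact: le_trans (rayleigh_subeigen y_ge0 cy) (rayleigh_le _ n0).
Qed.

(* Taking moduli in a complex eigenvector of maximal modulus gives [x >= 0] with
   [rho x <= x A]; this is equality because [rho] is the maximum of the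
   Rayleigh quotient. *)
Lemma perron_symmetric : (0 < n)%N -> (forall i j, 0 <= A i j) ->
  exists x : 'rV[R]_n, [/\ x != 0, forall i, 0 <= x 0 i & x *m A = rho *: x].
Proof.
move=> n0 A_ge0; have [z /eigenvalueP [v vA v0] zrho] := spectral_radius_eigen n0.
pose x : 'rV[R]_n := \row_i Normc.normc (v 0 i).
have xC i : toC (x 0 i) = `|v 0 i| by rewrite mxE.
have x_ge0 i : 0 <= x 0 i by rewrite -lecR xC; exact: normr_ge0.
exists x; split=> //.
  case/rV0Pn: v0 => i vi; apply/rV0Pn; exists i.
  by apply: contra vi => /eqP xi; rewrite -normr_eq0 -xC xi.
apply: rayleigh_eq => //; apply/eqP; rewrite eq_le rayleigh_le //=.
apply: rayleigh_subeigen => // j; rewrite -lecR rmorphM /= xC -zrho.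
have -> : toC (Normc.normc z) = `|z| by [].
rewrite -normrM; have /matrixP/(_ 0 j) := vA; rewrite [RHS]mxE => <-.
rewrite !mxE rmorph_sum; apply: le_trans (ler_norm_sum _ _ _) _.
apply: ler_sum => i _; rewrite normrM rmorphM /= xC mxE.
by rewrite (ger0_norm (_ : 0 <= toC _)) // lecR.
Qed.

End SymmetricMatrix.

Section GraphSpectralRadius.
Variables (R : realType) (f : R -> R -> R) (G : sgraph).
Hypothesis f_pos : forall x y : R, 0 < x -> 0 < y -> 0 < f x y.
Hypothesis f_sym : forall x y : R, 0 < x -> 0 < y -> f x y = f y x.

Definition edge_weight (u v : G) : R :=
  if sedge u v then f (degree u)%:R (degree v)%:R else 0.

Lemma sedge_degree_gt0 (u v : G) : sedge u v -> 0 < (degree u)%:R :> R.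
Proof. by move=> uv; rewrite ltr0n card_gt0; apply/set0Pn; exists v; rewrite inE. Qed.

Lemma edge_weightC (u v : G) : edge_weight u v = edge_weight v u.
Proof.
rewrite /edge_weight [sedge v u](@sedge_sym G); case: ifP => // uv.
by apply: f_sym; [exact: sedge_degree_gt0 uv | rewrite (@sedge_sym G) in uv; exact: sedge_degree_gt0 uv].
Qed.

Lemma edge_weight_ge0 (u v : G) : 0 <= edge_weight u v.
Proof.
rewrite /edge_weight; case: ifP => // uv; apply/ltW/f_pos.
  exact: sedge_degree_gt0 uv.
by rewrite (@sedge_sym G) in uv; exact: sedge_degree_gt0 uv.
Qed.

Lemma f_adjacencyE i j : f_adjacency f G i j = edge_weight (enum_val i) (enum_val j).
Proof. by rewrite mxE. Qed.

Lemma f_adjacency_sym : (f_adjacency f G)^T = f_adjacency f G.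
Proof. by apply/matrixP => i j; rewrite mxE !f_adjacencyE edge_weightC. Qed.

Lemma mulmx_f_adjacency (x : 'rV[R]_#|G|) j :
  (x *m f_adjacency f G) 0 j =
  \sum_(v : G) edge_weight (enum_val j) v * x 0 (enum_rank v).
Proof.
rewrite mxE [RHS]big_enum_val; apply: eq_bigr => i _.
by rewrite f_adjacencyE enum_valK edge_weightC mulrC.
Qed.

Lemma f_spectral_radius_ge0 : (0 < #|G|)%N -> 0 <= f_spectral_radius f G.
Proof. exact/spectral_radius_ge0/f_adjacency_sym. Qed.

Lemma f_spectral_radius_perron : (0 < #|G|)%N ->
  exists x : G -> R, [/\ exists u, x u != 0, forall u, 0 <= x u
    & forall u, \sum_v edge_weight u v * x v = f_spectral_radius f G * x u].
Proof.
move=> G0; have A_ge0 i j : 0 <= f_adjacency f G i j.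
  by rewrite f_adjacencyE edge_weight_ge0.
have [x [/rV0Pn[i xi] x_ge0 xA]] := perron_symmetric f_adjacency_sym G0 A_ge0.
exists (fun u => x 0 (enum_rank u)); split=> // [|u].
  by exists (enum_val i); rewrite enum_valK.
have /matrixP/(_ 0 (enum_rank u)) := xA.
by rewrite mulmx_f_adjacency enum_rankK mxE.
Qed.

Lemma f_spectral_radius_ge_subeigen (c : R) (x : G -> R) :
  (exists u, x u != 0) -> (forall u, 0 <= x u) ->
  (forall u, c * x u <= \sum_v edge_weight u v * x v) ->
  c <= f_spectral_radius f G.
Proof.
move=> [u xu] x_ge0 cx; pose y : 'rV[R]_#|G| := \row_i x (enum_val i).
apply: (subeigen_le_spectral_radius f_adjacency_sym (y := y)) => [|i|i].
- by apply/rV0Pn; exists (enum_rank u); rewrite mxE enum_rankK.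
- by rewrite mxE.
rewrite mulmx_f_adjacency mxE (le_trans (cx _)) //.
by apply: ler_sum => v _; rewrite mxE enum_rankK.
Qed.

End GraphSpectralRadius.

Lemma big_option (S : Type) (idx : S) (op : Monoid.com_law idx) (T : finType)
    (F : option T -> S) :
  \big[op/idx]_o F o = op (F None) (\big[op/idx]_t F (Some t)).
Proof.
rewrite (bigD1 None) //=; congr (op _ _).
rewrite (reindex_omap Some id) /=; last by case.
by apply: eq_bigl => t; rewrite eqxx.
Qed.

Lemma eq_set2 (T : finType) (x y p q : T) : p != q ->
  ([set x; y] == [set p; q]) = (x == p) && (y == q) || (x == q) && (y == p).
Proof.
move=> pq; apply/eqP/idP => [E|]; last first.
  by case/orP => /andP[/eqP-> /eqP->] //; rewrite finset.setUC.
have : x \in [set p; q] by rewrite -E set21.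
have : p \in [set x; y] by rewrite E set21.
have : q \in [set x; y] by rewrite E set22.
rewrite !inE => qxy pxy /orP[] /eqP xE; move: pxy qxy; rewrite xE.
  by rewrite (eq_sym q p) (negPf pq) (eq_sym q y) eqxx /= => _ ->.
by rewrite (negPf pq) (eq_sym p y) eqxx /= => -> _; rewrite orbT.
Qed.

Lemma degree_sum (G : sgraph) (u : G) : degree u = (\sum_v sedge u v)%N.
Proof.
by rewrite /degree -sum1_card big_mkcond; apply: eq_bigr => v _; rewrite inE; case: sedge.
Qed.

Section Subdivision.
Variables (G : sgraph) (p q : G).
Hypothesis pq : sedge p q.

Lemma sedge_neq (u v : G) : sedge u v -> u != v.
Proof. by apply: contraTneq => ->; rewrite (@sedge_irr G). Qed.

Lemma degree_subdivide_new : degree (None : subdivide p q) = 2%N.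
Proof.
rewrite degree_sum big_option /= add0n.
rewrite (eq_bigr (fun t => if t \in [set p; q] then 1%N else 0%N)); last by move=> t; case: ifP.
by rewrite -big_mkcond sum1_card cards2 sedge_neq.
Qed.

Lemma degree_subdivide_old (u : G) : degree (Some u : subdivide p q) = degree u.
Proof.
have npq := sedge_neq pq; have qp : sedge q p by rewrite (@sedge_sym G).
rewrite !degree_sum big_option /= !inE.
have [->|up] := eqVneq u p.
  rewrite [RHS](bigD1 q) //= pq (bigD1 q) //= pq !eqxx add0n; congr (_ + _)%N.
  apply: eq_bigr => y yq.
  by rewrite eq_set2 // eqxx (negPf npq) (negPf yq) andbT.
have [->|uq] := eqVneq u q.
  rewrite [RHS](bigD1 p) //= qp (bigD1 p) //= qp finset.setUC !eqxx add0n; congr (_ + _)%N.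
  apply: eq_bigr => y yp.
  by rewrite eq_set2 // eqxx eq_sym (negPf npq) (negPf yp) andbT.
rewrite add0n; apply: eq_bigr => y _.
by rewrite eq_set2 // (negPf up) (negPf uq) andbT.
Qed.

End Subdivision.

(* If [p = a - x2] and [q = b - x3], the hypotheses give
   [(r + F2) p <= F22 q] and [(r + F3) q <= F22 p]. *)
Lemma triangle_eigen_le (R : realType) (r F22 F2 F3 F23 a b x2 x3 : R) :
  0 < r -> 0 < F22 -> F22 <= F2 -> F22 <= F3 -> F22 <= F23 ->
  0 <= x2 -> 0 <= x3 ->
  r * a = F22 * b + F2 * x2 -> r * b = F22 * a + F3 * x3 ->
  F2 * a + F23 * x3 <= r * x2 -> F3 * b + F23 * x2 <= r * x3 ->
  a <= x2 /\ b <= x3.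
Proof.
move=> r0 F0 F2F F3F F23F x20 x30 ra rb rx2 rx3.
have hp : (r + F2) * (a - x2) <= F22 * (b - x3).
  have := ler_wpM2r x30 F23F; lra.
have hq : (r + F3) * (b - x3) <= F22 * (a - x2).
  have := ler_wpM2r x20 F23F; lra.
move: hp hq; rewrite -(subr_le0 x2 a) -(subr_le0 x3 b).
move: (a - x2) (b - x3) => p q hp hq.
have [p0|p0] := lerP p 0; have [q0|q0] := lerP q 0; split=> //; exfalso.
- have : 0 < (r + F3) * q by rewrite mulr_gt0 //; lra.
  have : F22 * p <= 0 by rewrite mulr_ge0_le0 // ltW.
  lra.
- have : 0 < (r + F2) * p by rewrite mulr_gt0 //; lra.
  have : F22 * q <= 0 by rewrite mulr_ge0_le0 // ltW.
  lra.
- have := mulr_gt0 r0 p0; have := mulr_gt0 r0 q0.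
  have := ler_wpM2r (ltW p0) F2F; have := ler_wpM2r (ltW q0) F3F; lra.
- have := mulr_gt0 r0 p0; have := mulr_gt0 r0 q0.
  have := ler_wpM2r (ltW p0) F2F; have := ler_wpM2r (ltW q0) F3F; lra.
Qed.

Theorem theorem3p3 (R : realType) (f : R -> R -> R)
    (f_pos : forall x y : R, 0 < x -> 0 < y -> 0 < f x y)
    (f_sym : forall x y : R, 0 < x -> 0 < y -> f x y = f y x)
    (f_incr : forall x x' y : R, 0 < x -> 0 < y -> x <= x' -> f x y <= f x' y)
    (G : sgraph) (G_conn : connected_graph G) (v1 v2 v3 : G)
    (deg_v1 : degree v1 = 2%N)
    (neighbors_v1 : neighbors v1 = [set v2; v3])
    (v2v3_edge : sedge v2 v3) :
  f_spectral_radius f (subdivide v1 v2) <= f_spectral_radius f G.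
Proof.
have G0 : (0 < #|G|)%N by case: G_conn.
have G'0 : (0 < #|subdivide v1 v2|)%N by rewrite card_option.
have sv1 u : sedge v1 u = (u == v2) || (u == v3).
  by have /setP/(_ u) := neighbors_v1; rewrite !inE.
have e12 : sedge v1 v2 by rewrite sv1 eqxx.
have e13 : sedge v1 v3 by rewrite sv1 eqxx orbT.
have e21 : sedge v2 v1 by rewrite (@sedge_sym G).
have e31 : sedge v3 v1 by rewrite (@sedge_sym G).
have e32 : sedge v3 v2 by rewrite (@sedge_sym G).
have n12 := sedge_neq e12; have n13 := sedge_neq e13; have n23 := sedge_neq v2v3_edge.
have degN : degree (None : subdivide v1 v2) = 2%N by exact: degree_subdivide_new.
have degS u : degree (Some u : subdivide v1 v2) = degree u.
  exact: degree_subdivide_old.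
have [r0|r0] := lerP (f_spectral_radius f (subdivide v1 v2)) 0.
  by apply: le_trans r0 _; exact: f_spectral_radius_ge0.
have [x [[o xo] x_ge0 xE]] := f_spectral_radius_perron f_pos f_sym G'0.
move: (f_spectral_radius f (subdivide v1 v2)) r0 xE => r r0 xE.
pose d2 : R := (degree v2)%:R; pose d3 : R := (degree v3)%:R.
have deg_ge2 (u v w : G) : sedge u v -> sedge u w -> v != w -> 2 <= (degree u)%:R :> R.
  move=> uv uw vw; rewrite ler_nat -[2%N]/(true.+1) -vw -cards2 subset_leq_card //.
  by apply/fintype.subsetP => t; rewrite !inE => /orP[] /eqP->.
have d2_ge2 : 2 <= d2 by exact: deg_ge2 e21 v2v3_edge n13.
have d3_ge2 : 2 <= d3 by exact: deg_ge2 e31 e32 n12.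
pose a := x None; pose b := x (Some v1).
pose x2 := x (Some v2); pose x3 := x (Some v3).
have wNS u : edge_weight f (None : subdivide v1 v2) (Some u) =
    if (u == v1) || (u == v2) then f 2 (degree u)%:R else 0.
  by rewrite /edge_weight /= degN degS !inE.
have wSN u : edge_weight f (Some u : subdivide v1 v2) None =
    if (u == v1) || (u == v2) then f (degree u)%:R 2 else 0.
  by rewrite /edge_weight /= degN degS !inE.
have wSS u v : edge_weight f (Some u : subdivide v1 v2) (Some v) =
    if (u == v1) && (v == v2) || (u == v2) && (v == v1) then 0
    else edge_weight f u v.
  rewrite /edge_weight /= !degS eq_set2 //.
  by case: ifP => [/andP[-> /negPf->]//|]; case: ifP => //; case: sedge.
have eN : r * a = f 2 2 * b + f 2 d2 * x2.
  rewrite -xE big_option /= {1}/edge_weight /= mul0r add0r.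
  rewrite (bigD1 v1) //= (bigD1 v2) 1?eq_sym //= !wNS !eqxx orbT deg_v1 big1 ?addr0 //.
  by move=> u /andP[/negPf u1 /negPf u2]; rewrite wNS u1 u2 mul0r.
have e1 : r * b = f 2 2 * a + f 2 d3 * x3.
  rewrite -xE big_option /= wSN eqxx deg_v1; congr (_ + _).
  rewrite (bigD1 v3) //= wSS eqxx eq_sym (negPf n23) (negPf n12) /= big1 ?addr0.
    by rewrite /edge_weight e13 deg_v1.
  move=> u u3; rewrite wSS eqxx (negPf n12) orbF /=.
  by case: eqP => [_|/eqP u2]; rewrite ?mul0r // /edge_weight sv1 (negPf u2) (negPf u3) mul0r.
have e2 : r * x2 = f d2 2 * a + \sum_(v | v != v1) edge_weight f v2 v * x (Some v).
  rewrite -xE big_option /= wSN eqxx orbT; congr (_ + _).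
  rewrite (bigD1 v1) //= wSS !eqxx orbT mul0r add0r.
  by apply: eq_bigr => v /negPf vn; rewrite wSS eq_sym (negPf n12) vn andbF.
have eu u : u != v1 -> u != v2 -> r * x (Some u) = \sum_v edge_weight f u v * x (Some v).
  move=> /negPf u1 /negPf u2; rewrite -xE big_option /= wSN u1 u2 mul0r add0r.
  by apply: eq_bigr => v _; rewrite wSS u1 u2.
have w_ge0 u v : 0 <= edge_weight f u v by exact: edge_weight_ge0.
have t_ge0 u v : 0 <= edge_weight f u v * x (Some v) by rewrite mulr_ge0.
have d2_gt0 : 0 < d2 by lra.
have d3_gt0 : 0 < d3 by lra.
have two_gt0 : 0 < 2 :> R by lra.
have [ax2 bx3] : a <= x2 /\ b <= x3.
  apply: (triangle_eigen_le (r := r) (F22 := f 2 2) (F2 := f 2 d2) (F3 := f 2 d3)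
            (F23 := f d2 d3)) => //; first exact: f_pos.
  - by rewrite (f_sym 2 d2) // f_incr.
  - by rewrite (f_sym 2 d3) // f_incr.
  - by apply: le_trans (f_incr 2 d2 d3 _ _ _) => //; rewrite (f_sym 2 d3) // f_incr.
  - exact: x_ge0.
  - exact: x_ge0.
  - rewrite e2 (f_sym 2 d2) // lerD2l (bigD1 v3) 1?eq_sym //=.
    by rewrite {1}/edge_weight v2v3_edge lerDl sumr_ge0.
  rewrite eu 1?eq_sym // (bigD1 v1) //= (bigD1 v2) 1?eq_sym //= addrA.
  rewrite {1 2}/edge_weight e31 e32 deg_v1 (f_sym 2 d3) // (f_sym d2 d3) //.
  by rewrite lerDl sumr_ge0.
pose m := Num.max a b.
have am : a <= m by rewrite le_max lexx.
have bm : b <= m by rewrite le_max lexx orbT.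
pose y u := if u == v1 then m else x (Some u).
have xy u : x (Some u) <= y u by rewrite /y; case: eqP => // ->.
have wxy (P : pred G) u :
    \sum_(v | P v) edge_weight f u v * x (Some v) <= \sum_(v | P v) edge_weight f u v * y v.
  by apply: ler_sum => v _; rewrite ler_wpM2l.
have y_ge0 u : 0 <= y u by apply: le_trans (x_ge0 _) (xy u).
apply: (f_spectral_radius_ge_subeigen f_sym (x := y)) => //.
  case: o xo => [u|] xo.
    by exists u; rewrite gt_eqF // (lt_le_trans _ (xy u)) // lt0r xo x_ge0.
  by exists v1; rewrite /y eqxx gt_eqF // (lt_le_trans _ am) // lt0r xo x_ge0.
move=> u; have [->|u1] := eqVneq u v1.
  have -> : \sum_v edge_weight f v1 v * y v = f 2 d2 * x2 + f 2 d3 * x3.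
    rewrite (bigD1 v2) //= (bigD1 v3) 1?eq_sym //= big1 ?addr0.
      by rewrite /edge_weight e12 e13 /y !(eq_sym _ v1) (negPf n12) (negPf n13) deg_v1.
    by move=> v /andP[/negPf vn2 /negPf vn3]; rewrite /edge_weight sv1 vn2 vn3 mul0r.
  rewrite /y eqxx /m; have [_|_] := lerP a b.
    rewrite e1 lerD2r.
    apply: le_trans (ler_wpM2l (ltW (f_pos _ _ two_gt0 two_gt0)) ax2) _.
    by apply: ler_wpM2r; rewrite ?x_ge0 // (f_sym 2 d2) // f_incr.
  rewrite eN addrC lerD2l.
  apply: le_trans (ler_wpM2l (ltW (f_pos _ _ two_gt0 two_gt0)) bx3) _.
  by apply: ler_wpM2r; rewrite ?x_ge0 // (f_sym 2 d3) // f_incr.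
rewrite {1}/y (negPf u1); have [->|u2] := eqVneq u v2; last by rewrite eu.
rewrite e2 [leRHS](bigD1 v1) //= lerD // /edge_weight e21 deg_v1 /y eqxx.
by rewrite ler_wpM2l // ltW // f_pos.
Qed.
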